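(* Let $p$ be an odd prime. For $d\mid p-1$ put $\beta_d=\gcd\!\left(d,\frac{p-1}{2}\right)$ and $g_d=\gcd\!\left(\frac{p-1}{2}+d,\,p-1\right)$. Then $$\Psi^w_{\mathbb{Z}_{4p}}(x)=\frac{1}{2p-2}\sum_{d\mid p-1}\phi\!\left(\frac{p-1}{d}\right)\Big[\Big\{\big(1+x^{\frac{2p-2}{d}}\big)^{d}+\big(1+x^{\frac{2p-2}{g_d}}\big)^{g_d}\Big\}\big(1+x^{\frac{p-1}{\beta_d}}\big)^{2\beta_d}(1+x^2)(1+x)$$ $$-2\big(1+x^{\frac{p-1}{\beta_d}}\big)^{2\beta_d}(1+x)-2(1+x^2)(1+x)+2(1+x)\Big],$$ and hence $$\mathcal{E}^w(\mathbb{Z}_{4p})=\frac{1}{2p-2}\sum_{d\mid p-1}\phi\!\left(\frac{p-1}{d}\right)\Big[4^{\beta_d+1}\big(2^d+2^{g_d}\big)-2^{2\beta_d+2}-4\Big].$$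
   Context: $\phi$ is Euler's totient function. For a finite group $\mathcal{A}$ with identity $e$, let $G(\mathcal{A})=\{\Omega\subseteq\mathcal{A}:\Omega^{-1}=\Omega,\ \langle\Omega\rangle=\mathcal{A},\ e\notin\Omega\}$. $\mathrm{Aut}(\mathcal{A})$ acts on $G(\mathcal{A})$ by $\alpha\cdot\Omega=\alpha(\Omega)$. For $k\ge1$ let $a^w_k(\mathcal{A})$ be the number of orbits of $\mathrm{Aut}(\mathcal{A})$ on $\{\Omega\in G(\mathcal{A}):|\Omega|=k\}$ (the number of weak equivalence classes of Cayley graphs $C(\mathcal{A},\Omega)$ of degree $k$); $\Psi^w_{\mathcal{A}}(x)=\sum_{k=1}^{|\mathcal{A}|-1}a^w_k(\mathcal{A})x^k$ and $\mathcal{E}^w(\mathcal{A})=\Psi^w_{\mathcal{A}}(1)$. For cyclic groups $\mathbb{Z}_n$, $\mathrm{Aut}(\mathbb{Z}_n)$ consists of multiplications by units mod $n$. *)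

(* Defs.v *)
From HB Require Import structures.
From mathcomp Require Import all_boot all_order all_algebra all_fingroup.
Set Implicit Arguments. Unset Strict Implicit. Unset Printing Implicit Defensive.
Import GRing.Theory.

Local Open Scope group_scope.

Definition Gset (gT : finGroupType) : {set {set gT}} :=
  [set Om : {set gT} | [&& Om^-1 == Om, <<Om>> == [set: gT] & 1 \notin Om]].

Definition aw (gT : finGroupType) (k : nat) : nat :=
  #| (orbit 'P^* (Aut [set: gT])) @: [set Om in Gset gT | #|Om| == k] |.

Local Close Scope group_scope.
Local Open Scope ring_scope.

Definition Psiw (gT : finGroupType) : {poly rat} :=
  \sum_(1 <= k < #|gT|) ((aw gT k)%:R *: 'X^k).

Definition Ew (gT : finGroupType) : rat := (Psiw gT).[1].

(* Main.v *)
Require Import Defs.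
From HB Require Import structures.
From mathcomp Require Import all_boot all_order all_algebra all_fingroup.
From mathcomp Require Import all_solvable zify ring.
Import GRing.Theory.
Local Open Scope ring_scope.

(** By the Cauchy-Frobenius lemma, applied to units acting on [Z_n] by
    multiplication, [totient n *: Psiw 'Z_n] is the sum over the units [u] of the
    generating polynomials of the connection sets fixed by [u].  For [n = 4p] a
    set generates iff it lies neither in the even residues nor in the multiples
    of [p], and a set closed under [u] and [-1] is a union of orbits of
    [H = <u, -1>]; inclusion-exclusion then yields products of [1 + X^|O|] over
    orbits [O].  Orbit sizes only depend on the class of a residue modulo 2 and
    [p].  They are computed from the decomposition [<g> x <tau>] of the unit
    group, where [g] is a primitive root modulo [p] with [g = 1] modulo 4,
    [tau = 1 + 2p], and [-1 = g^((p-1)/2) tau]. *)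

(** * Subsets invariant under a group action *)

(** When [H] acts on [X], this is the generating polynomial, by cardinality, of the [H]-stable
    subsets of [X]: each orbit is independently taken or left out. *)
Definition orbgf {aT : finGroupType} {rT : finType} (to : {action aT &-> rT})
    (H : {set aT}) (X : {set rT}) : {poly rat} :=
  \prod_(O in orbit to H @: X) (1 + 'X^#|O|).

Section OrbitGF.
Variables (aT : finGroupType) (rT : finType) (to : {action aT &-> rT}).
Variable H : {group aT}.
Implicit Types A X Y : {set rT}.

Lemma mem_cover_orbits X (J : {set {set rT}}) x :
  J \subset orbit to H @: X -> (x \in cover J) = (orbit to H x \in J).
Proof.
move=> /subsetP sJ; apply/bigcupP/idP => [[O OJ] | OJ].
  have /imsetP[y _ OE] := sJ _ OJ; rewrite OE in OJ *.
  by move/orbit_eqP->.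
by exists (orbit to H x) => //; exact: orbit_refl.
Qed.

Lemma acts_cover_orbits X (J : {set {set rT}}) :
  J \subset orbit to H @: X -> [acts H, on cover J | to].
Proof.
move=> sJ; apply/actsP => a aH x; rewrite !(mem_cover_orbits X) //.
by have /orbit_eqP-> : to x a \in orbit to H x by exact: mem_orbit.
Qed.

(** Stable subsets of [X] correspond to sets [J] of orbits through [cover]. Cardinalities add over
    the disjoint orbits of [J], so the sum over [J] is the expansion of the product. *)
Lemma sum_acts_orbgf X : [acts H, on X | to] ->
  \sum_(A : {set rT} | (A \subset X) && [acts H, on A | to]) 'X^#|A|
  = orbgf to H X.
Proof.
move=> actX; rewrite /orbgf; set P := _ @: X.
have partP: partition P X by exact: orbit_partition.
have sub_cover (J : {set {set rT}}) : J \subset P -> cover J \subset X.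
  move=> sJP; rewrite -(cover_partition partP); apply/bigcupsP=> O OJ.
  by apply: (bigcup_sup O) => //; exact: (subsetP sJP).
transitivity (\sum_(J : {set {set rT}} | J \subset P)
                \prod_(O in J) ('X^#|O| : {poly rat})).
  rewrite (reindex_onto (@cover rT) (fun A => orbit to H @: A)) /=; last first.
    move=> A /andP[_ actA].
    by rewrite (cover_partition (orbit_partition actA)).
  apply: eq_big => [J|J /andP[/andP[sJX _] /eqP JE]].
    apply/andP/idP => [[/andP[sJX _] /eqP<-] | sJP]; first exact: imsetS.
    rewrite sub_cover //= (acts_cover_orbits X) //; split=> //.
    apply/eqP/setP=> O; apply/imsetP/idP => [[x + ->]|OJ].
      by rewrite (mem_cover_orbits X).
    have /imsetP[x _ OE] := subsetP sJP _ OJ.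
    by exists x => //; rewrite (mem_cover_orbits X) // -OE.
  have sJP : J \subset P by rewrite -JE; apply: imsetS.
  have /eqP <- : trivIset J.
    by apply: (trivIsetS sJP); case/and3P: partP.
  exact: (big_morph _ (exprD _) (expr0 _)).
(* The product is extended to all sets [O], with 0 in place of the monomial outside [P], so that
   distributivity applies; every [J] not contained in [P] then contributes 0. *)
transitivity (\prod_O ((if O \in P then 'X^#|O| else 0) + 1 : {poly rat})); last first.
  rewrite [RHS]big_mkcond /=; apply: eq_bigr => O _.
  by case: ifP => _; rewrite addrC ?addr0.
rewrite bigA_distr big_mkcond /=; apply: eq_bigr => J _.
case: ifPn => [/subsetP sJP | /subsetPn[O OJ OP]].
  by rewrite big_mkcond; apply: eq_bigr => O _; case: ifP => // /sJP ->.
by rewrite (bigD1 O) //= OJ (negPf OP) mul0r.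
Qed.

Lemma orbgfU X Y : [acts H, on X | to] -> [disjoint X & Y] ->
  orbgf to H (X :|: Y) = orbgf to H X * orbgf to H Y.
Proof.
move=> actX dXY; rewrite /orbgf imsetU.
under eq_bigl do rewrite inE.
apply: bigU => /=; rewrite -setI_eq0; apply/eqP/setP=> O; rewrite !inE.
apply/negP=> /andP[/imsetP[x xX ->] /imsetP[y yY xyE]].
have yX : y \in X by rewrite -(acts_sub_orbit _ actX) -xyE acts_sub_orbit.
by have /pred0P/(_ y) := dXY; rewrite /= yX yY.
Qed.

Lemma orbgf_const X m : [acts H, on X | to] ->
  {in X, forall x, #|orbit to H x| = m} ->
  orbgf to H X = (1 + 'X^m) ^+ (#|X| %/ m).
Proof.
move=> actX cX; rewrite /orbgf.
have cP O : O \in orbit to H @: X -> #|O| = m by case/imsetP=> x /cX <- ->.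
rewrite (eq_bigr (fun=> 1 + 'X^m)) => [|O /cP-> //].
rewrite prodr_const; congr (_ ^+ _).
(* For empty [X] the value of [m] is unconstrained; otherwise [m] is the size of an orbit, hence
   positive, as the cancellation requires. *)
have [->|[x xX]] := set_0Vmem X; first by rewrite imset0 !cards0 div0n.
rewrite (card_uniform_partition cP (orbit_partition actX)) mulnK //.
by rewrite -(cX x xX) card_gt0; apply/set0Pn; exists x; apply: orbit_refl.
Qed.
End OrbitGF.

(** * Units acting on [Z_n] *)

Lemma ltn_Zp n (x : 'Z_n) : (1 < n)%N -> (x < n)%N.
Proof. by move=> n_gt1; rewrite -[X in (_ < X)%N](Zp_cast n_gt1). Qed.

Lemma val_Zp_small n k : (1 < n)%N -> (k < n)%N -> (k%:R : 'Z_n) = k :> nat.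
Proof. by move=> n_gt1 lt_k; rewrite val_Zp_nat ?modn_small. Qed.

Section UnitAction.
Variables (n : nat) (n_gt1 : (1 < n)%N).

Lemma val_ZpM (x y : 'Z_n) : (x * y : 'Z_n) = ((x * y) %% n)%N :> nat.
Proof. by rewrite /=; congr (_ %% _)%N; exact: Zp_cast. Qed.

(** An automorphism [a] of the additive group is multiplication by [a 1], whose inverse is the
    preimage of 1; conversely, multiplication by a unit is injective and additive. *)
Lemma orbit_Aut_Zp (Om : {set 'Z_n}) :
  orbit 'P^* (Aut [set: 'Z_n]) Om = orbit 'U^* [set: {unit 'Z_n}] Om.
Proof.
apply/setP=> B; apply/orbitP/orbitP => [] [] /=.
  move=> a /[!inE] /andP[_ /morphicP aM] <-.
  have aD x y : a (x + y) = a x + a y by apply: aM; rewrite inE.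
  have aE x : a x = x * a 1.
    rewrite -[x in LHS]natr_Zp -[x in RHS]natr_Zp.
    elim: (x : nat) => [|k IH].
      by rewrite mul0r; apply: (addrI (a 0)); rewrite addr0 -aD addr0.
    by rewrite -natr1 mulrDl mul1r -IH aD.
  have ua : a 1 \is a GRing.unit.
    by apply/unitrPr; exists (a^-1%g 1); rewrite mulrC -aE permKV.
  exists (FinRing.unit 'Z_n ua) => //; first by rewrite inE.
  by apply: eq_imset => x; apply/esym/aE.
move=> u _ <-.
have inju : injective (fun x : 'Z_n => x * val u).
  by apply: mulIr; apply: (valP u).
exists (perm inju); last by apply: eq_imset => x; rewrite /= /aperm permE.
rewrite inE; apply/andP; split; first by apply/subsetP=> x; rewrite !inE.
by apply/morphicP=> x y _ _; rewrite !permE; apply: mulrDl.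
Qed.

(** Frobenius-Cauchy is applied to the connection sets of each size [k]; the sum over [k] is then
    moved inside and regroups the fixed sets by cardinality. *)
Lemma Psiw_Burnside :
  [acts [set: {unit 'Z_n}], on Gset 'Z_n | 'U^*] -> set0 \notin Gset 'Z_n ->
  (totient n)%:R *: Psiw 'Z_n =
  \sum_(u : {unit 'Z_n})
    \sum_(Om in Gset 'Z_n | ('U^*)%act Om u == Om) ('X^#|Om| : {poly rat}).
Proof.
move=> actG G0.
have cardZ : #|'Z_n| = n by rewrite card_ord Zp_cast.
rewrite /Psiw cardZ scaler_sumr.
have awE k : (totient n * aw 'Z_n k =
   \sum_(u : {unit 'Z_n})
     #|[set Om in Gset 'Z_n | (#|Om| == k) && (('U^*)%act Om u == Om)]|)%N.
  rewrite /aw (eq_imset _ orbit_Aut_Zp) -card_units_Zp ?(ltnW n_gt1) // mulnC.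
  rewrite -Frobenius_Cauchy; last first.
    apply/actsP=> u _ Om; have := acts_act actG (in_setT u) Om.
    by rewrite !inE card_setact => ->.
  apply: eq_big => [u|u _]; first by rewrite inE.
  by apply: eq_card => Om; rewrite !inE -andbA; congr (_ && _); rewrite sub1set inE.
transitivity (\sum_(1 <= k < n) \sum_(u : {unit 'Z_n})
   \sum_(Om in Gset 'Z_n | (('U^*)%act Om u == Om) && (k == #|Om|))
     ('X^#|Om| : {poly rat})).
  apply: eq_bigr => k _; rewrite scalerA -natrM awE natr_sum scaler_suml.
  apply: eq_bigr => u _; rewrite scaler_nat -sumr_const.
  apply: eq_big => [Om|Om]; first by rewrite inE andbCA andbC (eq_sym k) andbA.
  by rewrite inE => /and3P[_ /eqP-> _].
rewrite exchange_big /=; apply: eq_bigr => u _.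
rewrite (exchange_big_dep
  (fun Om => (Om \in Gset 'Z_n) && (('U^*)%act Om u == Om))) /=; last first.
  by move=> k Om _ /and3P[-> -> _].
apply: eq_bigr => Om /andP[OmG fixOm].
under eq_bigl do rewrite OmG fixOm /=.
(* The range of [k] misses no connection set: [Om] is nonempty by hypothesis and proper because it
   omits the additive identity. *)
rewrite big_nat1_eq card_gt0.
have -> /= : Om != set0 by apply: contraNneq G0 => <-.
have : Om \proper [set: 'Z_n].
  move: OmG; rewrite inE properT => /and3P[_ _].
  by apply: contraNneq => ->; rewrite inE.
by move/proper_card; rewrite cardsT cardZ => ->.
Qed.
End UnitAction.

Definition Zp_mults (n d : nat) : {set 'Z_n} := [set x : 'Z_n | (d %| x)%N].

Lemma group_set_Zp_mults n d (n_gt1 : (1 < n)%N) : (d %| n)%N ->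
  group_set (Zp_mults n d).
Proof.
move=> dn; apply/group_setP; split=> [|x y]; first by rewrite inE dvdn0.
rewrite !inE /= => dx dy.
by rewrite /dvdn modn_dvdm ?Zp_cast // -/(dvdn _ _) dvdn_add.
Qed.

(** If [Om] generates a proper subgroup [K], some prime [q] divides the index of [K], and all
    elements of [Om] are multiples of [q]. As [q] divides 4p, it is 2 or [p]. *)
Lemma generator_set_Zp4p p (hp : prime p) (hodd : odd p) (Om : {set 'Z_(4 * p)}) :
  (<<Om>> == [set: 'Z_(4 * p)])%g =
  ~~ (Om \subset Zp_mults (4 * p) 2) && ~~ (Om \subset Zp_mults (4 * p) p).
Proof.
have p_gt1 := prime_gt1 hp.
have n_gt1 : (1 < 4 * p)%N by lia.
have d2 : (2 %| 4 * p)%N by rewrite dvdn_mulr.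
have dp : (p %| 4 * p)%N by rewrite dvdn_mull.
apply/idP/idP => [/eqP gT | ].
  have ndiv d : (1 < d)%N -> (d %| 4 * p)%N -> ~~ (Om \subset Zp_mults (4 * p) d).
    move=> d_gt1 dn; apply/negP.
    rewrite -(gen_subG _ (Group (group_set_Zp_mults _ _ n_gt1 dn))) /= gT.
    move=> /subsetP/(_ 1).
    by rewrite !inE /= modn_small ?Zp_cast // dvdn1 => /(_ isT); lia.
  by rewrite !ndiv.
apply: contraTT => ngT; set K := <<Om>>%G.
have cardZ : #|[set: 'Z_(4 * p)]| = (4 * p)%N by rewrite cardsT card_ord Zp_cast.
have Kn : (#|K| %| 4 * p)%N by rewrite -[X in (_ %| X)%N]cardZ cardSg ?subsetT.
have K0 : (0 < #|K|)%N by apply: cardG_gt0.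
(* By Lagrange [#|K|] annihilates [x], so 4p divides [x * #|K|]. *)
have Kdiv x : x \in Om -> ((4 * p) %/ #|K| %| x)%N.
  move=> xOm; have xK : x \in K by apply: mem_gen.
  have : x * #|K|%:R = 0 by rewrite mulr_natr; exact: expg_cardG xK.
  move=> /(congr1 val); rewrite [LHS]val_ZpM // val_Zp_nat // modnMmr => /eqP.
  by rewrite -/(dvdn _ _) -{1}(divnK Kn) dvdn_pmul2r.
have ltK : (#|K| < 4 * p)%N.
  by rewrite -[X in (_ < X)%N]cardZ; apply: proper_card; rewrite properT.
have [q q_pr qd] : exists2 q, prime q & (q %| (4 * p) %/ #|K|)%N.
  exists (pdiv ((4 * p) %/ #|K|)); last exact: pdiv_dvd.
  by apply: pdiv_prime; rewrite ltn_divRL // mul1n.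
have sub : Om \subset Zp_mults (4 * p) q.
  by apply/subsetP=> x xO; rewrite inE (dvdn_trans qd) ?Kdiv.
have : (q %| 2 * 2 * p)%N by rewrite (dvdn_trans qd) // dvdn_div.
rewrite !Euclid_dvdM // !dvdn_prime2 // orbb negb_and !negbK.
by case/orP=> /eqP qE; move: sub; rewrite qE => ->; rewrite ?orbT.
Qed.

Definition Zp_neg1 (n : nat) : {unit 'Z_n} := FinRing.Unit (@unitrN1 'Z_n).

Lemma Zp_neg1_sqr n : (Zp_neg1 n ^+ 2 = 1)%g.
Proof. by apply: val_inj; rewrite FinRing.val_unitX /= sqrrN expr1n. Qed.

Lemma coprime4n m : coprime 4 m = odd m.
Proof. by rewrite -coprime2n; exact: (@coprime_pexpl 2 2 m). Qed.

(** * Residues modulo [4p] *)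

Section ResidueClasses.
Variables (p : nat) (hp : prime p) (hodd : odd p).
Let n := (4 * p)%N.
Let n_gt1 : (1 < n)%N. Proof. have := prime_gt1 hp; rewrite /n; lia. Qed.
Let d2 : (2 %| n)%N. Proof. by rewrite dvdn_mulr. Qed.
Let dp : (p %| n)%N. Proof. by rewrite dvdn_mull. Qed.

Lemma Zp_unitE (x : 'Z_n) : (x \is a GRing.unit) = ~~ (2 %| x)%N && ~~ (p %| x)%N.
Proof.
rewrite -[x in LHS]natr_Zp unitZpE // coprimeMl coprime4n.
by rewrite prime_coprime // dvdn2 negbK.
Qed.

Lemma dvdn_Zp_mulu d (x : 'Z_n) (u : {unit 'Z_n}) : prime d -> (d %| n)%N ->
  (d %| (x * val u)%R)%N = (d %| x)%N.
Proof.
move=> d_pr dn; rewrite val_ZpM // /dvdn modn_dvdm // -!/(dvdn _ _).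
rewrite mulnC Gauss_dvdr // prime_coprime //; apply/negP=> du.
have := valP u; rewrite /= -[X in X \is a _]natr_Zp unitZpE // => /(coprime_dvdl dn).
by rewrite prime_coprime // du.
Qed.

(* [b] records divisibility by 2 and [c] divisibility by [p]: the nonzero
   residues of order 4p, 2p or p, 4, and 2 form the classes (false, false),
   (true, false), (false, true) and (true, true). *)
Definition Zp4p_class (b c : bool) : {set 'Z_n} :=
  [set x : 'Z_n | [&& x != 0, (2 %| x)%N == b & (p %| x)%N == c]].

Lemma acts_Zp4p_class (H : {group {unit 'Z_n}}) b c :
  [acts H, on Zp4p_class b c | 'U].
Proof.
apply/actsP=> u _ x; rewrite !inE /= !dvdn_Zp_mulu //.
by rewrite -(mul0r (val u)) (inj_eq (mulIr (valP u))).
Qed.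

Lemma acts_Gset_Zp4p : [acts [set: {unit 'Z_n}], on Gset 'Z_n | 'U^*].
Proof.
have sub_act (u : {unit 'Z_n}) (Om : {set 'Z_n}) d : prime d -> (d %| n)%N ->
   ('U^*%act Om u \subset Zp_mults n d) = (Om \subset Zp_mults n d).
  move=> d_pr dn; apply/subsetP/subsetP => sO x.
    by move=> xO; move: (sO (x * val u) (mem_setact _ _ xO)); rewrite !inE dvdn_Zp_mulu.
  by case/imsetP=> y /sO + ->; rewrite !inE dvdn_Zp_mulu.
apply/actsP=> u _ Om; rewrite !inE !generator_set_Zp4p // !sub_act //.
congr [&& _, _ & _].
  have actN (y : 'Z_n) : 'U%act (- y) u = - 'U%act y u by exact: mulNr.
  have -> : (('U^*%act Om u)^-1)%g = 'U^*%act (Om^-1)%g u.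
    apply/setP=> x; rewrite inE; apply/imsetP/imsetP => [] [y yO xE].
      exists (- y); first by rewrite inE; have -> : (- y)^-1%g = y by exact: opprK.
      by rewrite actN -xE; apply/esym/opprK.
    exists (- y); first by move: yO; rewrite inE.
    by rewrite actN -xE.
  by rewrite (inj_eq (act_inj _ _)).
(* Here [1%g] is the additive identity 0, the only element that a unit sends to 0. *)
congr (~~ _); apply/imsetP/idP => [[y yO y0]|O0]; last first.
  by exists 0 => //; apply/esym/mul0r.
by have -> : 1%g = y by apply: (mulIr (valP u)); rewrite -[RHS]y0; apply: mul0r.
Qed.

Lemma set0_notin_Gset_Zp4p : set0 \notin Gset 'Z_n.
Proof. by rewrite inE generator_set_Zp4p // sub0set andbF. Qed.

(** Symmetry of [Om] is invariance under multiplication by -1, so it merges with invariance under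
    [u] into invariance under the group [H] they generate. *)
Lemma fixed_Gset_Zp4p (u : {unit 'Z_n}) (Om : {set 'Z_n}) :
  let H := <<[set u; Zp_neg1 n]>>%G in
  (Om \in Gset 'Z_n) && ('U^*%act Om u == Om) =
  [&& Om \subset [set~ 0], [acts H, on Om | 'U],
      ~~ (Om \subset Zp_mults n 2) & ~~ (Om \subset Zp_mults n p)].
Proof.
move=> H; rewrite !inE generator_set_Zp4p //.
rewrite gen_subG subUset !sub1set.
have actE v : (v \in 'N(Om | 'U)%G) = ('U^*%act Om v == Om).
  apply/idP/eqP => [/astabs_setact // | /astab1P].
  by rewrite (astab1_set 'U).
have actN : 'U^*%act Om (Zp_neg1 n) = Om^-1%g.
  apply/setP=> x; rewrite inE; apply/imsetP/idP => [[y yO ->]|xO].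
    by rewrite (_ : _^-1%g = y) //= /FinRing.unit_act mulrN1 [LHS]opprK.
  by exists (x^-1%g); rewrite //= /FinRing.unit_act mulrN1; apply/esym/opprK.
rewrite !actE actN subsetC sub1set inE.
rewrite -!/n; case: (_^-1%g == _); case: (_ \subset _); case: (_ \subset _) => /=;
  rewrite ?andbF ?andbT //; exact: andbC.
Qed.

(** The four terms count the [H]-stable sets of nonzero residues: all of them, those of even
    residues, those of multiples of [p], and those satisfying both conditions. *)
Lemma sum_fixed_Gset_Zp4p (u : {unit 'Z_n}) :
  let H := <<[set u; Zp_neg1 n]>>%G in
  let gf := orbgf 'U H in
  \sum_(Om in Gset 'Z_n | ('U^*)%act Om u == Om) 'X^#|Om| =
  gf (Zp4p_class false false) * gf (Zp4p_class true false)
    * gf (Zp4p_class false true) * gf (Zp4p_class true true)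
  - gf (Zp4p_class true false) * gf (Zp4p_class true true)
  - gf (Zp4p_class false true) * gf (Zp4p_class true true)
  + gf (Zp4p_class true true).
Proof.
move=> H gf; under eq_bigl do rewrite fixed_Gset_Zp4p.
pose cl := Zp4p_class.
have mem_cl b c x : (x \in cl b c) = [&& x != 0, (2 %| x)%N == b & (p %| x)%N == c].
  by rewrite inE.
have aC b c : [acts H, on cl b c | 'U] by exact: acts_Zp4p_class.
have aU (A B : {set 'Z_n}) : [acts H, on A | 'U] -> [acts H, on B | 'U] ->
    [acts H, on A :|: B | 'U].
  by move=> aA aB; apply/actsP=> v vH x; rewrite !inE (acts_act aA) // (acts_act aB).
have dis (A B : {set 'Z_n}) : (forall x, x \in A -> x \in B -> False) -> [disjoint A & B].
  by move=> AB; apply/pred0P=> x /=; apply/negP => /andP[]; apply: AB.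
have gfU b c (B : {set 'Z_n}) : [disjoint cl b c & B] ->
    gf (cl b c :|: B) = gf (cl b c) * gf B.
  by apply: orbgfU; apply: aC.
have e1 : gf (cl true false :|: cl true true) = gf (cl true false) * gf (cl true true).
  by rewrite gfU //; apply: dis => x; rewrite !mem_cl => /and3P[_ _ /eqP->] /and3P[].
have e2 : gf (cl false true :|: cl true true) = gf (cl false true) * gf (cl true true).
  by rewrite gfU //; apply: dis => x; rewrite !mem_cl => /and3P[_ /eqP-> _] /and3P[].
have e3 : gf (cl false false :|: (cl true false :|: (cl false true :|: cl true true))) =
   gf (cl false false) * (gf (cl true false) * (gf (cl false true) * gf (cl true true))).
  rewrite 2?gfU ?e2 //; apply: dis => x; rewrite !inE.
    by case: (2 %| _)%N; case: (p %| _)%N; rewrite ?andbF.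
  by case: (2 %| _)%N; case: (p %| _)%N; rewrite ?andbF.
have s3 : cl false false :|: (cl true false :|: (cl false true :|: cl true true)) = [set~ 0].
  apply/setP=> x; rewrite !inE.
  by case: (2 %| _)%N; case: (p %| _)%N; rewrite ?andbF ?andbT ?orbF ?orbT.
have s1 : cl true false :|: cl true true = [set~ 0] :&: Zp_mults n 2.
  apply/setP=> x; rewrite !inE.
  by case: (2 %| _)%N; case: (p %| _)%N; rewrite ?andbF ?andbT ?orbF ?orbT.
have s2 : cl false true :|: cl true true = [set~ 0] :&: Zp_mults n p.
  apply/setP=> x; rewrite !inE.
  by case: (2 %| _)%N; case: (p %| _)%N; rewrite ?andbF ?andbT ?orbF ?orbT.
have s0 : cl true true = [set~ 0] :&: Zp_mults n 2 :&: Zp_mults n p.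
  apply/setP=> x; rewrite !inE.
  by case: (2 %| _)%N; case: (p %| _)%N; rewrite ?andbF ?andbT ?orbF ?orbT.
rewrite -!mulrA -e3 -e1 -e2 -!/(cl _ _) /gf -!sum_acts_orbgf ?aU ?aC //.
(* All sums now range over every set [A], so the identity is checked for each [A] on the truth
   values of the conditions. *)
rewrite s3 s1 s2 s0 !(big_mkcond (fun A => _ && _)) -!sumrB -big_split.
apply: eq_bigr => A _; rewrite !(subsetI A).
case: (A \subset [set~ 0]); case: [acts H, on A | 'U];
case: (A \subset Zp_mults n 2); case: (A \subset Zp_mults n p);
  by rewrite /= ?subr0 ?addr0 ?subrr ?sub0r ?addNr.
Qed.
End ResidueClasses.

(** * Orbit sizes on the four residue classes *)

Section OrbitSizes.
Variables (p : nat) (hp : prime p) (hodd : odd p).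
Let n := (4 * p)%N.
Let n_gt1 : (1 < n)%N. Proof. have := prime_gt1 hp; rewrite /n; lia. Qed.
Let dp : (p %| n)%N. Proof. by rewrite dvdn_mull. Qed.
Let p_gt2 : (2 < p)%N. Proof. exact: odd_prime_gt2. Qed.
Local Notation cl := (Zp4p_class p).

Lemma totient_4p : totient n = (2 * p.-1)%N.
Proof.
by rewrite /n totient_coprime ?coprime4n // (totient_prime hp).
Qed.

Lemma Zp4p_class_tt : cl true true = [set (2 * p)%:R].
Proof.
have vE : ((2 * p)%:R : 'Z_n) = (2 * p)%N :> nat by rewrite val_Zp_small // /n; lia.
apply/setP=> x; rewrite !inE !eqb_id -!val_eqE /= [X in _ = (_ == X)]vE.
have ltx := ltn_Zp _ x n_gt1; apply/idP/eqP => [/and3P[x0 x2 xp] | ->].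
  have : (2 * p %| x)%N by rewrite Gauss_dvd ?coprime2n ?x2.
  by case/dvdnP=> k xE; move: x0 ltx; rewrite xE /n; case: k {xE} => [|[|k]]; nia.
by rewrite dvdn_mulr // dvdn_mull // !andbT; lia.
Qed.

Lemma Zp4p_class_ft : cl false true = [set p%:R; (3 * p)%:R].
Proof.
have vE : (p%:R : 'Z_n) = p :> nat by rewrite val_Zp_small // /n; lia.
have v3E : ((3 * p)%:R : 'Z_n) = (3 * p)%N :> nat by rewrite val_Zp_small // /n; lia.
apply/setP=> x; rewrite !inE eqb_id eqbF_neg -!val_eqE /=.
rewrite [X in _ = (_ == X) || _]vE [X in _ = _ || (_ == X)]v3E !dvdn2 negbK.
have ltx := ltn_Zp _ x n_gt1; apply/idP/orP => [/and3P[x0 x2 /dvdnP[k xE]] | ].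
  move: x2 ltx x0; rewrite xE oddM hodd andbT /n.
  by case: k {xE} => [|[|[|[|k]]]] //= _; rewrite ?mul1n ?eqxx; [left|right|nia].
case=> /eqP ->; rewrite ?oddM ?hodd ?dvdn_mull ?dvdnn //; lia.
Qed.

Lemma card_Zp4p_class_ff : #|cl false false| = (2 * p.-1)%N.
Proof.
rewrite -totient_4p -card_units_Zp ?(ltnW n_gt1) //.
rewrite -(card_imset _ (@val_inj _ _ {unit 'Z_n})); apply: eq_card => x.
rewrite !inE !eqbF_neg -Zp_unitE //; apply/andP/imsetP => [[_ ux]|[u _ ->]].
  by exists (FinRing.Unit ux); rewrite ?inE.
split; last exact: (valP u).
by apply: contraTneq (valP u) => ->; rewrite unitr0.
Qed.

Lemma card_Zp4p_class_ft : #|cl false true| = 2%N.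
Proof. by rewrite Zp4p_class_ft cards2 -val_eqE /= !val_Zp_small // /n; lia. Qed.

(** Found by subtracting 0 and the other three classes from the 4p residues. *)
Lemma card_Zp4p_class_tf : #|cl true false| = (2 * p.-1)%N.
Proof.
have cardZ : #|'Z_n| = n by rewrite card_ord Zp_cast.
have : #|[set: 'Z_n]| = (#|[set (0 : 'Z_n)%R]| + #|cl false false| + #|cl true false|
   + #|cl false true| + #|cl true true|)%N.
  rewrite -!sum1_card !(big_mkcond (fun x => x \in _)) -!big_split.
  apply: eq_bigr => x _; rewrite !inE.
  by case: eqP => [->|_] //=; case: (2 %| _)%N; case: (p %| _)%N.
rewrite cardsT cardZ cards1 card_Zp4p_class_ff card_Zp4p_class_ft.
rewrite Zp4p_class_tt cards1 /n; lia.
Qed.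

(** This class is the set of units, on which multiplication is free, so every orbit has [#|H|]
    elements. *)
Lemma orbgf_class_ff (H : {group {unit 'Z_n}}) :
  orbgf 'U H (cl false false) = (1 + 'X^#|H|) ^+ (2 * p.-1 %/ #|H|).
Proof.
rewrite -card_Zp4p_class_ff; apply: orbgf_const; first exact: acts_Zp4p_class.
move=> x; rewrite inE !eqbF_neg -Zp_unitE // => /andP[_ ux].
rewrite card_orbit; suff -> : 'C_H[x | 'U]%g = 1%g by rewrite indexg1.
apply/trivgP/subsetP=> u /setIP[_ /astab1P] /= xu; apply/set1P/val_inj.
by apply: (mulrI ux); rewrite [LHS]xu mulr1.
Qed.

Lemma orbgf_class_tt (H : {group {unit 'Z_n}}) : orbgf 'U H (cl true true) = 1 + 'X.
Proof.
rewrite (orbgf_const _ _ _ _ _ 1%N) ?acts_Zp4p_class //.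
  by rewrite Zp4p_class_tt cards1.
move=> x xC; apply/eqP; rewrite eqn_leq card_gt0.
have -> : orbit 'U H x != set0 by apply/set0Pn; exists x; apply: orbit_refl.
rewrite andbT -(cards1 ((2 * p)%:R : 'Z_n)) -Zp4p_class_tt subset_leq_card //.
by rewrite acts_sub_orbit ?acts_Zp4p_class.
Qed.

(** The class is {p, 3p}, and -1 exchanges its two elements. *)
Lemma orbgf_class_ft (H : {group {unit 'Z_n}}) : Zp_neg1 n \in H ->
  orbgf 'U H (cl false true) = 1 + 'X^2.
Proof.
move=> NH; have c2 := card_Zp4p_class_ft.
rewrite (orbgf_const _ _ _ _ _ 2%N) ?acts_Zp4p_class ?c2 ?divnn ?expr1 //.
move=> x xC; apply/eqP; rewrite eqn_leq.
rewrite -{1}c2 subset_leq_card ?acts_sub_orbit ?acts_Zp4p_class //=.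
have xN : x != - x.
  (* If [x] equals its opposite, then 4p divides 2x, so [x] is even and falls outside the class. *)
  apply: contraTneq xC => xE; have : x * 2%:R = 0.
    by rewrite mulr_natr mulr2n {1}xE addNr.
  move=> /(congr1 val); rewrite [LHS]val_ZpM // val_Zp_small //; last by rewrite /n; lia.
  move=> /eqP/dvdnP[k]; rewrite /n => xk.
  have x2 : (2 %| x)%N.
    apply/dvdnP; exists (k * p)%N.
    by move: (nat_of_ord x) xk => m xk; nia.
  by rewrite inE x2 andbF.
have <- : #|[set x; - x]| = 2%N by rewrite cards2 xN.
apply: subset_leq_card; rewrite subUset !sub1set orbit_refl.
by apply/orbitP; exists (Zp_neg1 n); rewrite //= /FinRing.unit_act mulrN1.
Qed.

Lemma Zp_tau_proof : ((1 + 2 * p)%:R : 'Z_n) \is a GRing.unit.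
Proof.
rewrite unitZpE // coprimeMl coprime4n oddD oddM /=.
by rewrite /coprime addnC gcdnMDl gcdn1.
Qed.

(* The unit congruent to 1 modulo [p] and to -1 modulo 4. *)
Definition Zp_tau : {unit 'Z_n} := FinRing.Unit Zp_tau_proof.

Lemma Zp_tauE : (val Zp_tau) = (1 + 2 * p)%N :> nat.
Proof. by rewrite val_Zp_small // /n; lia. Qed.

Lemma Zp_tau_sqr : (Zp_tau ^+ 2 = 1)%g.
Proof.
apply: val_inj; rewrite FinRing.val_unitX /= -natrX.
have -> : ((1 + 2 * p) ^ 2 = n * p.+1 + 1)%N by rewrite /n; nia.
suff : (n * p.+1 + 1)%:R = 1%:R :> 'Z_n by [].
by apply: val_inj; rewrite [LHS]val_Zp_nat // [RHS]val_Zp_nat // mulnC modnMDl.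
Qed.

(** If [u] fixes [x], then [p] divides [x * (u - 1)] but not [x], so [u] is 1 modulo [p]; being odd,
    it is 1 or 1 + 2p. Conversely 1 + 2p fixes every even residue. *)
Lemma astab1_Zp4p_class_tf (x : 'Z_n) : x \in cl true false ->
  'C[x | 'U]%g = <[Zp_tau]>%g.
Proof.
rewrite inE eqb_id eqbF_neg => /and3P[x0 /dvdnP[y xE] px].
apply/eqP; rewrite eqEsubset cycle_subG; apply/andP; split; last first.
  apply/astab1P/val_inj; rewrite [LHS]val_ZpM // Zp_tauE xE.
  have -> : (y * 2 * (1 + 2 * p) = y * n + y * 2)%N by rewrite /n; nia.
  by rewrite modnMDl modn_small // -xE ltn_Zp.
apply/subsetP=> u /astab1P/(congr1 val); rewrite [LHS]val_ZpM // => xuE.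
have /andP[u2 _] : ~~ (2 %| val u)%N && ~~ (p %| val u)%N.
  by rewrite -Zp_unitE //; apply: (valP u).
have ltu := ltn_Zp _ (val u) n_gt1.
have puE : (p %| (val u).-1)%N.
  have : (n %| x * (val u).-1)%N.
    rewrite -subn1 mulnBr muln1 -eqn_mod_dvd; last first.
      by rewrite leq_pmulr //; case: (nat_of_ord _) u2.
    by rewrite xuE modn_small // ltn_Zp.
  by move/(dvdn_trans dp); rewrite Euclid_dvdM // (negPf px).
(* Write [u] as kp + 1 with k < 4; since [u] and [p] are odd, k is even, hence 0 or 2. *)
have [] : (val u = 1 :> nat \/ val u = 1 + 2 * p :> nat)%N.
  case/dvdnP: puE => k kE.
  have uE : nat_of_ord (val u) = (k * p).+1.
    by move: u2 kE; case: (nat_of_ord _) => //= m _ ->.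
  move: ltu u2; rewrite uE dvdn2 /= negbK oddM hodd andbT /n.
  case: k {kE uE} => [|[|[|[|k]]]] //= lt_k _.
  - by left.
  - by right; lia.
  - nia.
  move=> u1; have -> : u = 1%g.
    by apply/val_inj/val_inj; rewrite [LHS]u1 /= modn_small // Zp_cast.
  exact: group1.
move=> u1; have -> : u = Zp_tau by apply/val_inj/val_inj; rewrite [LHS]u1 [RHS]Zp_tauE.
exact: cycle_id.
Qed.

Lemma orbgf_class_tf (H : {group {unit 'Z_n}}) :
  let m := #|H : H :&: <[Zp_tau]>|%g in
  orbgf 'U H (cl true false) = (1 + 'X^m) ^+ (2 * p.-1 %/ m).
Proof.
move=> m; rewrite -card_Zp4p_class_tf; apply: orbgf_const; first exact: acts_Zp4p_class.
by move=> x /astab1_Zp4p_class_tf stE; rewrite card_orbit stE.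
Qed.
End OrbitSizes.

(** * The unit group modulo [4p] *)

Section GroupLemmas.
Local Open Scope group_scope.
Variable gT : finGroupType.
Implicit Types (x y : gT) (K : {group gT}).

Lemma gen2_commute x y : commute x y -> <<[set x; y]>> = <[x]> * <[y]>.
Proof.
move=> cxy; rewrite -cent_joinEr ?cycle_subG /=; first by rewrite joing_idl joing_idr.
by rewrite cent_cycle; apply/cent1P.
Qed.

Lemma card_gen2_involution x y : commute x y -> y ^+ 2 = 1 -> y \notin <[x]> ->
  #|<<[set x; y]>>| = (2 * #[x])%N.
Proof.
move=> cxy y2 yx.
have oy : #[y] = 2%N.
  by apply: nt_prime_order => //; apply: contraNneq yx => ->; rewrite group1.
rewrite gen2_commute // TI_cardMg ?[#|<[y]>|]oy 1?mulnC //.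
by rewrite setIC prime_TIg ?[#|<[y]>|]oy // cycle_subG.
Qed.

Lemma gen2_mull x y : <<[set x * y; y]>> = <<[set x; y]>>.
Proof.
apply/eqP; rewrite eqEsubset !gen_subG !subUset !sub1set.
have yin z : y \in <<[set z; y]>> by rewrite mem_gen // !inE eqxx orbT.
have xin z : z \in <<[set z; y]>> by rewrite mem_gen // !inE eqxx.
by rewrite groupM ?yin ?xin //= -(groupMr _ (yin _)) xin.
Qed.

Lemma groupX_gcdn K x i j : x ^+ i \in K -> x ^+ j \in K -> x ^+ gcdn i j \in K.
Proof.
move=> xi xj; have [->|i_gt0] := posnP i; first by rewrite gcd0n.
(* This form of Bezout makes [gcdn i j + a * j] a multiple of [i], which avoids negative
   exponents. *)
have [a _ /dvdnP[b eb]] := Bezoutl j i_gt0.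
have: x ^+ (gcdn i j + a * j) \in K by rewrite eb mulnC expgM groupX.
by rewrite expgD groupMr // mulnC expgM groupX.
Qed.

(** The elements [u] of index [d] are exactly the generators of [<[x ^+ d]>], and their number is
    the totient of [#[x] %/ d]. This produces the totient weights of the final formula. *)
Lemma sum_cycle_order (V : nmodType) (f : nat -> V) x :
  (\sum_(u in <[x]>) f (#[x] %/ #[u])%N =
  \sum_(d <- divisors #[x]) f d *+ totient (#[x] %/ d)%N)%R.
Proof.
have x0 := order_gt0 x.
have du u : u \in <[x]> -> (#[u] %| #[x])%N by exact: order_dvdG.
transitivity (\sum_(u in <[x]>) \sum_(d <- divisors #[x] | (#[x] %/ #[u])%N == d) f d)%R.
  apply: eq_bigr => u ux; rewrite big_mkcond.
  rewrite (bigD1_seq (#[x] %/ #[u])%N) ?divisors_uniq //=.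
    by rewrite eqxx big1 ?addr0 // => d /negPf; rewrite eq_sym => ->.
  by rewrite -dvdn_divisors // dvdn_div ?du.
rewrite (exchange_big_dep xpredT) //= big_seq [RHS]big_seq.
apply: eq_bigr => d; rewrite -dvdn_divisors // => dx.
have d_gt0 : (0 < d)%N by exact: dvdn_gt0 dx.
have oxd : #[x ^+ d] = (#[x] %/ d)%N by rewrite orderXdiv.
rewrite sumr_const -oxd totient_gen; congr (_ *+ _)%R; apply: eq_card => u.
rewrite [RHS]inE [LHS]inE /generator.
apply/andP/eqP => [[ux /eqP dE]|uE].
  apply/eqP; rewrite (eq_subG_cyclic (cycle_cyclic x)) ?cycle_subG ?mem_cycle //.
  by rewrite -![#|_|]/(#[_]) oxd -dE divnA ?du // mulKn.
have ou : #[u] = (#[x] %/ d)%N by rewrite -oxd /order uE.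
split; first by rewrite -cycle_subG -uE cycle_subG mem_cycle.
by rewrite ou divnA // mulKn.
Qed.
End GroupLemmas.

(* As [a] and [b] have the same gcd with [2 * h], [b = - e * a] modulo [2 * h]
   for some [e], which can be chosen odd; then [h + b = - e * (h + a)]. *)
Lemma gcdn_half_addl_dvd h a b : (0 < h)%N -> gcdn a (2 * h) = gcdn b (2 * h) ->
  (gcdn (h + a) (2 * h) %| gcdn (h + b) (2 * h))%N.
Proof.
move=> h0; set m := (2 * h)%N; set d := gcdn a m => dE.
have m0 : (0 < m)%N by rewrite /m; lia.
have d0 : (0 < d)%N by rewrite gcdn_gt0 m0 orbT.
have [da dm] : (d %| a)%N /\ (d %| m)%N by rewrite dvdn_gcdl dvdn_gcdr.
have db : (d %| b)%N by rewrite dE dvdn_gcdl.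
have [e e_odd meb] : exists2 e, odd e & (m %| b + e * a)%N.
  have [c _ mc] := Bezoutl a m0; rewrite gcdnC -/d in mc.
  have me0 : (m %| b + c * (b %/ d) * a)%N.
    have -> : (b + c * (b %/ d) * a = (d + c * a) * (b %/ d))%N.
      by rewrite mulnDl [(d * _)%N]mulnC divnK // mulnAC.
    exact: dvdn_mulr.
  set e0 := (c * (b %/ d))%N in me0.
  have [e0_odd|e0_even] := boolP (odd e0); first by exists e0.
  exists (e0 + m %/ d)%N; last first.
    by rewrite mulnDl addnA dvdn_addr // -(divnK da) mulnA mulnAC divnK // dvdn_mulr.
  (* If [e0] and [m %/ d] were both even, [b %/ d] would be even too, and 2d would divide the gcd of
     [b] and [m], which is [d]. *)
  rewrite oddD (negPf e0_even) /=; apply: contraT => mde.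
  have md2 : (2 %| m %/ d)%N by rewrite dvdn2.
  have : (m %/ d %| b %/ d + e0 * (a %/ d))%N.
    by rewrite -(dvdn_pmul2r d0) mulnDl -mulnA !divnK.
  move/(dvdn_trans md2); rewrite dvdn_addl => [bd2|]; last first.
    by apply: dvdn_mulr; rewrite dvdn2.
  have : (2 * d %| gcdn b m)%N by rewrite dvdn_gcd -!dvdn_divRL // bd2 md2.
  by rewrite -dE => /dvdn_leq; lia.
rewrite dvdn_gcd dvdn_gcdr andbT.
have Dm : (gcdn (h + a) m %| m)%N by exact: dvdn_gcdr.
rewrite -(dvdn_addl _ (dvdn_mull e (dvdn_gcdl (h + a) m))).
have -> : (h + b + e * (h + a) = (e.+1) * h + (b + e * a))%N by lia.
rewrite dvdn_addl ?(dvdn_trans Dm) //.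
by rewrite dvdn_pmul2r // dvdn2 /= e_odd.
Qed.

Lemma gcdn_half_addl h a b : (0 < h)%N -> gcdn a (2 * h) = gcdn b (2 * h) ->
  gcdn (h + a) (2 * h) = gcdn (h + b) (2 * h).
Proof. by move=> h0 ab; apply/eqP; rewrite eqn_dvd !gcdn_half_addl_dvd. Qed.

Lemma unit_Zp_expg_eq1 m (m_gt1 : (1 < m)%N) (u : {unit 'Z_m}) k :
  (u ^+ k == 1)%g = ((val u : nat) ^ k == 1 %[mod m])%N.
Proof.
rewrite -val_eqE FinRing.val_unitX -[X in X ^+ k]natr_Zp -natrX -val_eqE /=.
by rewrite val_Zp_nat // [X in _ = (_ == X)]modn_small //= modn_small // Zp_cast.
Qed.

Section UnitGroup.
Variables (p : nat) (hp : prime p) (hodd : odd p).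
Let n := (4 * p)%N.
Let n_gt1 : (1 < n)%N. Proof. have := prime_gt1 hp; rewrite /n; lia. Qed.
Let p_gt2 : (2 < p)%N. Proof. exact: odd_prime_gt2. Qed.
Local Notation tau := (Zp_tau p hp hodd).

(** A primitive root modulo [p] is lifted by the Chinese remainder theorem to a residue that is 1
    modulo 4; the lift keeps its order, because its powers are trivial modulo 4. *)
Lemma Zp4p_generator :
  exists2 g : {unit 'Z_n}, (val g = 1 %[mod 4])%N & #[g]%g = p.-1.
Proof.
have /cyclicP[r rE] := units_Zp_cyclic hp.
have or : #[r]%g = p.-1 by rewrite /order -rE card_units_Zp ?prime_gt0 // totient_prime.
have co4p : coprime 4 p by rewrite coprime4n.
pose c := chinese 4 p 1 (val r).
have c4 : (c = 1 %[mod 4])%N by exact: chinese_modl.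
have cp : (c = val r %[mod p])%N by exact: chinese_modr.
have uc : (c%:R : 'Z_n) \is a GRing.unit.
  rewrite unitZpE // coprimeMl; apply/andP; split.
    by rewrite -coprime_modr c4.
  rewrite -coprime_modr cp coprime_modr -unitZpE ?prime_gt1 // natr_Zp.
  exact: (valP r).
pose g : {unit 'Z_n} := FinRing.Unit uc.
have vg : val g = (c %% n)%N :> nat by rewrite [LHS]val_Zp_nat.
exists g; first by rewrite vg modn_dvdm ?dvdn_mulr.
have gE k : (g ^+ k == 1)%g = (r ^+ k == 1)%g.
  rewrite (unit_Zp_expg_eq1 _ n_gt1) (unit_Zp_expg_eq1 _ (prime_gt1 hp)).
  rewrite vg modnXm chinese_remainder //.
  by rewrite -modnXm c4 modnXm exp1n eqxx /= -modnXm cp modnXm.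
rewrite -or; apply/eqP; rewrite eqn_dvd !order_dvdn.
by rewrite gE expg_order -gE expg_order !eqxx.
Qed.

Lemma Zp4p_mod4_notin_cycle (g u : {unit 'Z_n}) :
  (val g = 1 %[mod 4])%N -> (val u <> 1 %[mod 4])%N -> (u \notin <[g]>)%g.
Proof.
move=> g4 u4; apply/negP=> /cycleP[k uE]; apply: u4; rewrite uE.
elim: k {uE} => [|k IH]; first by rewrite modn_dvdm // Zp_cast ?dvdn_mulr.
by rewrite expgS [X in (X %% _)%N]val_ZpM // modn_dvdm ?dvdn_mulr // -modnMm g4 IH.
Qed.

Lemma Zp_tau_mod4 : (val tau <> 1 %[mod 4])%N.
Proof. by rewrite Zp_tauE; lia. Qed.

Lemma Zp_neg1_val : val (Zp_neg1 n) = n.-1 :> nat.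
Proof.
have -> : val (Zp_neg1 n) = n.-1%:R.
  apply/esym/eqP; rewrite -addr_eq0 natr1 prednK; last by rewrite ltnW.
  by rewrite -val_eqE /= val_Zp_nat // modnn.
by rewrite val_Zp_small // ltn_predL ltnW.
Qed.

Lemma Zp_neg1_mod4 : (val (Zp_neg1 n) <> 1 %[mod 4])%N.
Proof. by rewrite Zp_neg1_val /n; lia. Qed.

Section Generator.
Variable g : {unit 'Z_n}.
Hypotheses (g4 : (val g = 1 %[mod 4])%N) (og : #[g]%g = p.-1).
Let h := (p.-1)./2.
Let h_gt0 : (0 < h)%N. Proof. by rewrite /h; lia. Qed.
Let pE : p.-1 = (2 * h)%N.
Proof. by rewrite /h; lia. Qed.

(** Modulo 4 the factors are 1 and -1; modulo [p] they are -1 and 1, since [g ^+ h] has square 1 but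
    is not 1. *)
Lemma Zp_neg1E : Zp_neg1 n = (g ^+ h * tau)%g.
Proof.
set c : nat := val g.
have co4p : coprime 4 p by rewrite coprime4n.
have c4 : (c ^ h = 1 %[mod 4])%N by rewrite -modnXm g4 modnXm exp1n.
have c0 : (0 < c ^ h)%N by case: (c ^ h)%N c4.
have pc : (p %| c ^ h + 1)%N.
  have : (p %| (c ^ h + 1) * (c ^ h - 1))%N.
    rewrite mulnC -subn_sqr exp1n -expnM mulnC -pE -eqn_mod_dvd ?expn_gt0; last first.
      by move: c0; rewrite !expn_gt0 => /orP[->//|/eqP h0]; move: h_gt0; rewrite h0.
    have /eqP : (g ^+ p.-1 = 1)%g by rewrite -og expg_order.
    by rewrite unit_Zp_expg_eq1 // chinese_remainder // => /andP[_].
  (* The other factor would make [g ^+ h] equal to 1 modulo [p], hence modulo 4p, against the order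
     of [g]. *)
  rewrite Euclid_dvdM // => /orP[//|]; rewrite -eqn_mod_dvd // => cp.
  have : (g ^+ h == 1)%g.
    by rewrite unit_Zp_expg_eq1 // chinese_remainder // cp andbT; apply/eqP.
  by rewrite -order_dvdn og pE => /dvdn_leq; rewrite h_gt0; lia.
apply: val_inj; rewrite /= FinRing.val_unitX -[val g]natr_Zp -/c -natrX -natrM.
apply/esym/eqP; rewrite -addr_eq0 natr1 -val_eqE /= val_Zp_nat // -/(dvdn _ _).
rewrite Gauss_dvd //; apply/andP; split.
  rewrite /dvdn -addn1 -modnDml -modnMml c4 modnMml modnDml mul1n; lia.
have -> : ((c ^ h * (1 + 2 * p)).+1 = (c ^ h + 1) + 2 * c ^ h * p)%N by lia.
by rewrite dvdn_add // dvdn_mull.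
Qed.

Lemma card_gen_neg1 (x : {unit 'Z_n}) : x \in <[g]>%g ->
  #|<<[set x; Zp_neg1 n]>>%g| = (2 * #[x]%g)%N.
Proof.
move=> xg; rewrite card_gen2_involution ?Zp_neg1_sqr //.
  by apply: (centsP (units_Zp_abelian _)); rewrite inE.
have := Zp4p_mod4_notin_cycle _ _ g4 Zp_neg1_mod4; apply: contra.
by apply: subsetP; rewrite cycle_subG.
Qed.

(** Since -1 is [g ^+ h * tau] and 2h is the order of [g], multiplying [g ^+ (h + i)] by -1 gives
    [g ^+ i * tau]. This shift by [h] is the origin of the quantity g_d. *)
Lemma gen_tau_neg1 i :
  <<[set g ^+ i * tau; Zp_neg1 n]>>%g = <<[set g ^+ (h + i); Zp_neg1 n]>>%g.
Proof.
rewrite -[RHS]gen2_mull; congr (<<[set _; _]>>)%g.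
have cgt : commute tau (g ^+ h)%g by apply: (centsP (units_Zp_abelian _)); rewrite inE.
rewrite Zp_neg1E addnC expgD -!mulgA; congr (_ * _)%g.
by rewrite mulgA -expgD addnn -mul2n -pE -og expg_order mul1g.
Qed.

(** Modulo [tau], [u] becomes [g ^+ i] and -1 becomes [g ^+ h], so [H * <[tau]>] is generated by
    [g ^+ gcdn i h] and [tau]. Both forms of [u] thus give the same index, which is why one beta_d
    serves both cosets. *)
Lemma index_gen_neg1_tau u i (H := <<[set u; Zp_neg1 n]>>%G) :
  u = (g ^+ i)%g \/ u = (g ^+ i * tau)%g ->
  #|H : H :&: <[tau]>|%g = (p.-1 %/ gcdn i h)%N.
Proof.
move=> uE; set e := gcdn i h.
have tg : (tau \notin <[g]>)%g by exact: Zp4p_mod4_notin_cycle g4 Zp_tau_mod4.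
have cU (x y : {unit 'Z_n}) : commute x y.
  by apply: (centsP (units_Zp_abelian _)); rewrite inE.
have tge : (tau \notin <[g ^+ e]>)%g.
  by apply: contra tg; apply: subsetP; rewrite cycle_subG mem_cycle.
have tg1 : (tau != 1)%g by apply: contraNneq tg => ->; apply: group1.
have ot : #|<[tau]>%g| = 2%N by apply: nt_prime_order => //; apply: Zp_tau_sqr.
have eh : (e %| p.-1)%N by rewrite pE dvdn_mull // dvdn_gcdr.
apply/eqP; rewrite indexgI -(eqn_pmul2r (cardG_gt0 <[tau]>)) LagrangeMr ot.
have -> : (H * <[tau]> = <<[set g ^+ e; tau]>>)%g.
  rewrite -norm_joinEr; last first.
    by apply: cents_norm; apply/centsP=> x _ y _; apply: cU.
  set K := (H <*> <[tau]>)%G; apply/eqP; rewrite eqEsubset.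
  have tK : tau \in K by rewrite (subsetP (joing_subr _ _)) ?cycle_id.
  have uK : u \in K.
    by rewrite (subsetP (joing_subl _ _)) // mem_gen // !inE eqxx.
  have gK : (g ^+ i)%g \in K.
    by case: uE uK => ->; rewrite // groupMr.
  have hK : (g ^+ h)%g \in K.
    rewrite -(groupMr _ tK) -Zp_neg1E (subsetP (joing_subl _ _)) //.
    by rewrite mem_gen // !inE eqxx orbT.
  apply/andP; split; last by rewrite gen_subG subUset !sub1set tK groupX_gcdn.
  set L := <<[set (g ^+ e)%g; tau]>>%G.
  have tL : tau \in L by rewrite mem_gen // !inE eqxx orbT.
  have eL k : (e %| k)%N -> (g ^+ k)%g \in L.
    by move=> /dvdnP[q ->]; rewrite mulnC expgM groupX // mem_gen // !inE eqxx.
  rewrite join_subG cycle_subG tL andbT gen_subG subUset !sub1set.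
  apply/andP; split; last by rewrite Zp_neg1E groupM ?eL ?dvdn_gcdr.
  by case: uE => ->; rewrite ?groupM ?eL ?dvdn_gcdl.
rewrite (card_gen2_involution _ _ _ (cU _ _) (Zp_tau_sqr _ _ _) tge) mulnC.
by rewrite orderXdiv ?og.
Qed.

(** The unit group is the disjoint union of [<[g]>] and its coset by [tau]: by cardinality, [g] and
    [tau] generate all 2(p - 1) units. *)
Lemma sum_units_Zp4p (V : nmodType) (F : {unit 'Z_n} -> V) :
  \sum_u F u = \sum_(u in <[g]>%g) (F u + F (u * tau)%g).
Proof.
have tg : (tau \notin <[g]>)%g by exact: Zp4p_mod4_notin_cycle g4 Zp_tau_mod4.
rewrite big_split /= (bigID (fun u => u \in <[g]>%g)) /=; congr (_ + _).
rewrite (reindex_inj (mulIg tau)) /=; apply: eq_bigl => u.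
apply/idP/idP => [utg|ug]; last by rewrite groupMl.
have cgt : commute g tau by apply: (centsP (units_Zp_abelian _)); rewrite inE.
have : u \in (<[g]> * <[tau]>)%g.
  rewrite -gen2_commute //.
  suff /eqP -> : <<[set g; tau]>>%g == [set: {unit 'Z_n}] by rewrite inE.
  rewrite eqEcard subsetT card_gen2_involution ?Zp_tau_sqr // og.
  by rewrite (card_units_Zp (ltnW n_gt1)) (totient_4p _ hp hodd) leqnn.
case/mulsgP => _ _ /cycleP[i ->] /cycleP[j ->] uE.
(* Only the parity of [j] matters; for odd [j] the product [u * tau] would lie in [<[g]>]. *)
move: utg; rewrite uE -(expg_mod j (Zp_tau_sqr _ _ _)) modn2.
case: (odd j) => /=; rewrite ?mulg1 ?mem_cycle //.
by rewrite -mulgA [(tau * tau)%g](Zp_tau_sqr _ hp hodd) mulg1 mem_cycle.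
Qed.

End Generator.
End UnitGroup.

(* [a] is the number of orbits of [<u, -1>] on the units of [Z_4p], and [2 * b]
   its number of orbits on the nonzero even residues prime to [p]. *)
Definition fixed_gf (p a b : nat) : {poly rat} :=
  (1 + 'X^((2 * p.-1) %/ a)) ^+ a * (1 + 'X^(p.-1 %/ b)) ^+ (2 * b) * (1 + 'X^2) * (1 + 'X)
  - (1 + 'X^(p.-1 %/ b)) ^+ (2 * b) * (1 + 'X) - (1 + 'X^2) * (1 + 'X) + (1 + 'X).

Lemma sum_fixed_Gset_fixed_gf (p : nat) (hp : prime p) (hodd : odd p) a b
    (u : {unit 'Z_(4 * p)}) (H := <<[set u; Zp_neg1 (4 * p)]>>%G) :
  (0 < a)%N -> (0 < b)%N -> (a %| p.-1)%N -> (b %| p.-1)%N ->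
  #|H| = (2 * (p.-1 %/ a))%N ->
  #|H : H :&: <[Zp_tau p hp hodd]>|%g = (p.-1 %/ b)%N ->
  \sum_(Om in Gset 'Z_(4 * p) | ('U^*)%act Om u == Om) 'X^#|Om| = fixed_gf p a b.
Proof.
move=> a0 b0 ap bp cH iH; rewrite sum_fixed_Gset_Zp4p // -/H /fixed_gf.
have p1_gt0 : (0 < p.-1)%N by have := prime_gt1 hp; lia.
have NH : Zp_neg1 (4 * p) \in H by rewrite mem_gen // !inE eqxx orbT.
have e1 : (2 * p.-1 %/ (2 * (p.-1 %/ a)) = a)%N.
  by rewrite divnMl // divnA // mulKn.
have e2 : (2 * p.-1 %/ (p.-1 %/ b) = 2 * b)%N.
  by rewrite -muln_divA ?dvdn_div // divnA // mulKn.
rewrite orbgf_class_ff // orbgf_class_tt // orbgf_class_ft // (orbgf_class_tf _ hp hodd).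
by rewrite cH iH e1 e2 muln_divA.
Qed.

(** * Summation over the units and evaluation at 1 *)

Theorem theorem4p5 (p : nat) (hp : prime p) (hodd : odd p) :
  let beta d := gcdn d ((p - 1) %/ 2) in
  let g d := gcdn ((p - 1) %/ 2 + d) (p - 1) in
  Psiw 'Z_(4 * p) =
    ((2 * p - 2)%:R)^-1 *:
    \sum_(d <- divisors (p - 1))
      (totient ((p - 1) %/ d))%:R *:
      ( ((1 + 'X^((2 * p - 2) %/ d)) ^+ d + (1 + 'X^((2 * p - 2) %/ g d)) ^+ g d)
          * (1 + 'X^((p - 1) %/ beta d)) ^+ (2 * beta d) * (1 + 'X^2) * (1 + 'X)
        - 2%:R * (1 + 'X^((p - 1) %/ beta d)) ^+ (2 * beta d) * (1 + 'X)
        - 2%:R * (1 + 'X^2) * (1 + 'X)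
        + 2%:R * (1 + 'X) : {poly rat})
  /\
  Ew 'Z_(4 * p) =
    ((2 * p - 2)%:R)^-1 *
    \sum_(d <- divisors (p - 1))
      (totient ((p - 1) %/ d))%:R *
      ( (4 ^ (beta d + 1) * (2 ^ d + 2 ^ g d))%:R
        - (2 ^ (2 * beta d + 2))%:R - 4%:R : rat).
Proof.
move=> beta g.
have p_gt2 : (2 < p)%N by exact: odd_prime_gt2.
set m := (p - 1)%N; have mE : p.-1 = m by rewrite /m subn1.
have m2E : (2 * p - 2 = 2 * m)%N by rewrite /m; lia.
have m2_neq0 : (2 * m)%:R != 0 :> rat by rewrite Num.Theory.pnatr_eq0 /m; lia.
set h := (m %/ 2)%N in beta g *.
have mh : m = (2 * h)%N by rewrite /h /m; lia.
have h_gt0 : (0 < h)%N by rewrite /h /m; lia.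
have m_gt0 : (0 < m)%N by rewrite mh muln_gt0.
have PsiE : Psiw 'Z_(4 * p) = (2 * m)%:R^-1 *: \sum_(d <- divisors m)
   (totient (m %/ d))%:R *: (fixed_gf p d (beta d) + fixed_gf p (g d) (beta d)).
  have n_gt1 : (1 < 4 * p)%N by lia.
  apply: (scalerI m2_neq0); rewrite scalerA divff // scale1r.
  have tE : totient (4 * p) = (2 * m)%N by rewrite totient_4p // mE.
  rewrite -{1}tE Psiw_Burnside ?set0_notin_Gset_Zp4p ?acts_Gset_Zp4p //.
  have [x x4 ox] := Zp4p_generator p hp hodd.
  rewrite (sum_units_Zp4p _ hp hodd _ x4 ox).
  have oxm : #[x]%g = m by rewrite ox.
  under [RHS]eq_bigr do rewrite scaler_nat.
  rewrite -[in RHS]oxm -sum_cycle_order; apply: eq_bigr => _ /cycleP[i ->].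
  have hE : (p.-1)./2 = h by rewrite /h -mE divn2.
  (* The divisor [d] attached to [x ^+ i] is [gcdn i m]; the next two facts express beta_d and g_d
     directly in terms of [i]. *)
  have dE : (#[x]%g %/ #[(x ^+ i)%g]%g = gcdn i m)%N.
    by rewrite orderXgcd oxm divnA ?dvdn_gcdl // mulKn // gcdnC.
  rewrite dE.
  have bE : beta (gcdn i m) = gcdn i h.
    by rewrite /beta -gcdnA; congr gcdn; apply/gcdn_idPr; rewrite mh dvdn_mull.
  have gE : g (gcdn i m) = gcdn (h + i) m.
    by rewrite /g -/m mh; apply: gcdn_half_addl => //; rewrite -gcdnA gcdnn.
  (* The first summand comes from the unit [x ^+ i], the second from its product with tau, whose
     group is that of [x ^+ (h + i)] and -1. *)
  rewrite bE gE; congr (_ + _).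
    apply: (sum_fixed_Gset_fixed_gf _ hp hodd);
      rewrite ?mE ?dvdn_gcdr ?gcdn_gt0 ?m_gt0 ?h_gt0 ?orbT //.
    - by rewrite mh dvdn_mull // dvdn_gcdr.
    - by rewrite (card_gen_neg1 _ hp hodd _ x4) ?mem_cycle // orderXgcd oxm gcdnC.
    - by rewrite -mE (index_gen_neg1_tau _ hp hodd _ x4 ox _ i (or_introl erefl)) hE.
  apply: (sum_fixed_Gset_fixed_gf _ hp hodd);
    rewrite ?mE ?dvdn_gcdr ?gcdn_gt0 ?m_gt0 ?h_gt0 ?orbT //.
  - by rewrite mh dvdn_mull // dvdn_gcdr.
  - rewrite /= (gen_tau_neg1 _ hp hodd _ x4 ox) hE.
    by rewrite (card_gen_neg1 _ hp hodd _ x4) ?mem_cycle // orderXgcd oxm gcdnC.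
  - by rewrite -mE (index_gen_neg1_tau _ hp hodd _ x4 ox _ i (or_intror erefl)) hE.
rewrite /Ew PsiE m2E; split.
  congr (_ *: _); apply: eq_bigr => d _; congr (_ *: _).
  rewrite /fixed_gf mE; move: (_ ^+ d) (_ ^+ g d) (_ ^+ (2 * beta d)) => A B C.
  ring.
rewrite hornerZ horner_sum; congr (_ * _); apply: eq_bigr => d _.
rewrite hornerZ; congr (_ * _).
(* At 1 every factor 1 + X^k becomes 2, whatever [k], so only the numbers of orbits remain, as
   exponents. *)
have e2 k : (1 + 'X^k).[1] = 2%:R :> rat by rewrite !hornerE expr1n.
have e1 : (1 + 'X).[1] = 2%:R :> rat by rewrite !hornerE.
have e4 k : (4 ^ (k + 1))%:R = 4%:R * 2%:R ^+ (2 * k) :> rat.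
  by rewrite addn1 expnS natrM (natrX _ 4) exprM; congr (_ * _ ^+ _).
rewrite /fixed_gf !(e1, e2, hornerD, hornerN, hornerM, horner_exp).
rewrite natrM natrD e4 !natrX exprD.
move: (_ ^+ d) (_ ^+ g d) (_ ^+ (2 * beta d)) => A B C.
ring.
Qed.
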